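(* Let $k=(k(n))_{n\ge 0}$ be a real sequence with $\sum_{n=0}^\infty |k(n)|<\infty$, and suppose that the solution $r$ of the resolvent equation $r(n+1)=\sum_{j=0}^{n}k(n-j)r(j)$, $n\ge 0$, $r(0)=1$, satisfies $\sum_{n=0}^\infty |r(n)|<\infty$. Let $H=(H(n))_{n\ge 0}$ be a real sequence, $\xi\in\mathbb{R}$, and let $x$ be the solution of $$x(n+1)=\sum_{j=0}^{n}k(n-j)x(j)+H(n+1),\quad n\ge 0;\qquad x(0)=\xi.$$ If $\phi:[0,\infty)\to[0,\infty)$ is an increasing convex function, then $$\limsup_{n\to\infty}\frac1n\sum_{j=0}^{n}\phi(|x(j)|)\le\limsup_{n\to\infty}\frac1n\sum_{j=0}^{n}\phi\big(|r|_1\,|H(j)|\big).$$ Similarly, $$\limsup_{n\to\infty}\frac1n\sum_{j=0}^{n}\phi(|H(j)|)\le\limsup_{n\to\infty}\frac1n\sum_{j=0}^{n}\phi\big((1+|k|_1)\,|x(j)|\big).$$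
   Context: $|r|_1=\sum_{j=0}^\infty|r(j)|$ and $|k|_1=\sum_{j=0}^\infty|k(j)|$. Limits superior take values in $[0,\infty]$. The value $H(0)$ does not enter the equation for $x$. *)

(* Defs.v *)
From HB Require Import structures.
From mathcomp Require Export all_boot all_order all_algebra.
From mathcomp Require Export all_classical all_reals all_analysis.
Export Order.TTheory GRing.Theory Num.Theory.
Export numFieldNormedType.Exports.

Set Implicit Arguments.
Unset Strict Implicit.
Unset Printing Implicit Defensive.

Local Open Scope classical_set_scope.
Local Open Scope ring_scope.

Definition abs_summable (R : realType) (u : R^nat) : Prop :=
  cvgn [normed series u].

(* Meaningful only when [abs_summable u] holds. *)
Definition l1norm (R : realType) (u : R^nat) : R :=
  limn [normed series u].

(* [(k * u)(n) = \sum_(j = 0)^n k(n - j) u(j)]; the truncated subtraction is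
   harmless since j <= n. *)
Definition convolution (R : realType) (k u : R^nat) : R^nat :=
  fun n => \sum_(0 <= j < n.+1) k (n - j)%N * u j.

Definition is_resolvent (R : realType) (k r : R^nat) : Prop :=
  r 0%N = 1 /\ forall n, r n.+1 = convolution k r n.

Definition is_volterra_solution (R : realType) (k H : R^nat) (xi : R)
    (x : R^nat) : Prop :=
  x 0%N = xi /\ forall n, x n.+1 = convolution k x n + H n.+1.

(* [limsup_n (1/n) \sum_(j = 0)^n u(j)] in the extended reals.  There are n + 1
   summands but the factor is 1/n; the junk term at n = 0 (where 0^-1 = 0) does
   not affect the limit superior. *)
Definition limsup_mean (R : realType) (u : R^nat) : \bar R :=
  limn_esup (fun n => (n%:R^-1 * \sum_(0 <= j < n.+1) u j)%:E).

(* Main.v *)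
Require Import Defs.
From mathcomp Require Import ring lra.

(** Write [a * u] for the convolution of [a] and [u], and let [h] be [H] with
its value at [0] replaced by [xi].  The equation for [x] says that [h] and [x]
determine each other by convolution:
    [x = r * h]    and    [h = a * x], with [a = (1, - k 0, - k 1, ...)].
The kernels have l^1-norms [|r|_1] and [|a|_1 = 1 + |k|_1], so both halves of
the theorem are instances of one inequality ([sum_phi_convolution]): if
[|a|_1 <= A] then, for every [N],
    [\sum_(n < N) phi |(a * u) n| <= \sum_(n < N) phi (A |u n|)].

To prove it, put [w = |a| / A], a kernel of total mass at most one, and
[psi = phi - phi 0], which is nonnegative, increasing and convex on the
half-line and vanishes at [0].  Jensen's inequality, with the missing mass
placed at [0], gives [psi |(a * u) n| <= (w * psi (A |u|)) n]
([jensen_sub0]).  Summing over [n < N], each [psi (A |u j|)] is counted with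
total weight [\sum_(i < N - j) w i <= 1] ([sum_convolution]).  Adding [N phi 0]
to both sides restores [phi], so that no limit has to be taken to absorb
[phi 0].

Going back from [h] to [H] changes the partial sums by a constant, which the
factor [1/n] sends to zero ([limsup_mean_le]). *)

Set Implicit Arguments.
Unset Strict Implicit.
Unset Printing Implicit Defensive.

Local Open Scope classical_set_scope.
Local Open Scope ring_scope.

(** * Jensen's inequality for weights of total mass at most one *)

Lemma convex_function_comb2 (R : realType) (phi : R -> R)
    (phi_convex : convex_function (`[0, +oo[%classic : set R) phi) (p a b : R) :
  0 <= p <= 1 -> 0 <= a -> 0 <= b ->
  phi (p * a + (1 - p) * b) <= p * phi a + (1 - p) * phi b.
Proof.
move=> p01 a0 b0.
have ain : a \in (`[0, +oo[%classic : set R) by rewrite inE /= in_itv /= a0.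
have bin : b \in (`[0, +oo[%classic : set R) by rewrite inE /= in_itv /= b0.
have p01' : Itv.spec (@Itv.num_sem R) (Itv.Real `[0%Z, 1%Z]) p.
  by rewrite /= /Itv.num_sem /= in_itv /= p01 ger0_real //; case/andP: p01.
exact: (phi_convex (Itv.mk p01') a b ain bin).
Qed.

(** The missing mass sits at an arbitrary base point [b].  Letting [b] vary is
what makes the induction work: the [n]-th term and [b] merge into a single base
point, so the other weights need no renormalization. *)
Lemma jensen_subprobability (R : realType) (phi : R -> R)
    (phi_convex : convex_function (`[0, +oo[%classic : set R) phi)
    (w t : R^nat) (n : nat) (b : R) :
  (forall i, 0 <= w i) -> (forall i, 0 <= t i) -> 0 <= b ->
  \sum_(0 <= i < n) w i <= 1 ->
  phi (\sum_(0 <= i < n) w i * t i + (1 - \sum_(0 <= i < n) w i) * b)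
    <= \sum_(0 <= i < n) w i * phi (t i)
       + (1 - \sum_(0 <= i < n) w i) * phi b.
Proof.
move=> w0 t0; elim: n b => [|n IHn] b b0.
  by rewrite !big_nil subr0 !mul1r !add0r.
rewrite !big_nat_recr //=; set S := \sum_(0 <= i < n) w i => S1.
have wn0 := w0 n; have [S_eq1|S_neq1] := eqVneq S 1.
  have wn : w n = 0 by lra.
  have := IHn b b0; rewrite -/S wn S_eq1 => /(_ (lexx _)).
  by rewrite !mul0r !addr0.
have Slt1 : 0 < 1 - S by rewrite subr_gt0 lt_neqAle S_neq1 /=; lra.
pose p := w n / (1 - S).
have pE : w n = (1 - S) * p by rewrite /p; field; rewrite gt_eqF.
have p01 : 0 <= p <= 1.
  by rewrite divr_ge0 ?(ltW Slt1) //= ler_pdivrMr //; lra.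
have [p0 p1] := andP p01.
have b'0 : 0 <= p * t n + (1 - p) * b.
  by rewrite addr_ge0 // mulr_ge0 // subr_ge0.
have Sle1 : S <= 1 by lra.
have := IHn _ b'0 Sle1; rewrite -/S => IH.
have /(ler_wpM2l (ltW Slt1)) conv2 := convex_function_comb2 phi_convex p01 (t0 n) b0.
rewrite pE; apply: le_trans (le_trans IH _).
  by rewrite le_eqVlt; apply/orP; left; apply/eqP; congr phi; ring.
by lra.
Qed.

(** With the base point at [0], the missing mass contributes nothing once
[phi] is normalized to vanish at [0]. *)
Lemma jensen_sub0 (R : realType) (phi : R -> R)
    (phi_convex : convex_function (`[0, +oo[%classic : set R) phi)
    (w t : R^nat) (n : nat) :
  (forall i, 0 <= w i) -> (forall i, 0 <= t i) ->
  \sum_(0 <= i < n) w i <= 1 ->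
  phi (\sum_(0 <= i < n) w i * t i) - phi 0
    <= \sum_(0 <= i < n) w i * (phi (t i) - phi 0).
Proof.
move=> w0 t0 w1; have := jensen_subprobability phi_convex w0 t0 (lexx 0) w1.
under [X in _ -> _ <= X]eq_bigr do rewrite mulrBr.
by rewrite mulr0 addr0 sumrB -mulr_suml; lra.
Qed.

(** * Convolution with a summable kernel *)

(** The weight of [u j] collects [a (n - j)] for [j <= n < N]. *)
Lemma sum_convolution (R : realType) (a u : R^nat) (N : nat) :
  \sum_(0 <= n < N) convolution a u n
    = \sum_(0 <= j < N) (\sum_(0 <= i < N - j) a i) * u j.
Proof.
elim: N => [|N IHN]; first by rewrite !big_nil.
rewrite big_nat_recr //= IHN /convolution !big_nat_recr //= addrA.
rewrite subSnn subnn big_nat1 -big_split /=; congr (_ + _).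
apply: eq_big_nat => j /andP[_ jN].
by rewrite subSn 1?ltnW // big_nat_recr //= mulrDl.
Qed.

(** Young's inequality for convolution with an l^1 kernel, in convex form;
[phi t = t ^+ p] gives the usual l^p bound on each initial segment. *)
Lemma sum_phi_convolution (R : realType) (phi : R -> R) (a u : R^nat) (A : R)
    (N : nat)
    (phi_increasing : {in `[0, +oo[ &, {homo phi : s t / s <= t}})
    (phi_convex : convex_function (`[0, +oo[%classic : set R) phi) :
  0 < A -> (forall n, \sum_(0 <= i < n) `|a i| <= A) ->
  \sum_(0 <= n < N) phi `|convolution a u n|
    <= \sum_(0 <= n < N) phi (A * `|u n|).
Proof.
move=> A0 aA.
pose w i := `|a i| / A.
pose psi t := phi t - phi 0.
have incr s t : 0 <= s -> s <= t -> phi s <= phi t.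
  by move=> s0 st; apply: phi_increasing; rewrite ?in_itv /= ?s0 ?(le_trans s0 st).
have w0 i : 0 <= w i by rewrite divr_ge0 // ltW.
have w1 n : \sum_(0 <= i < n) w i <= 1.
  by rewrite -mulr_suml ler_pdivrMr // mul1r.
have t0 j : 0 <= A * `|u j| by rewrite mulr_ge0 // ltW.
have pointwise n : psi `|convolution a u n|
    <= convolution w (fun j => psi (A * `|u j|)) n.
  have dom : `|convolution a u n| <= \sum_(0 <= j < n.+1) w (n - j)%N * (A * `|u j|).
    apply: le_trans (ler_norm_sum _ _ _) _; apply: ler_sum => j _.
    by rewrite normrM /w mulrA divfK // gt_eqF.
  (* The weights of u 0, ..., u n are w 0, ..., w n read backwards. *)
  have wrev : \sum_(0 <= j < n.+1) w (n - j)%N <= 1.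
    rewrite big_nat_rev /= add0n; apply: le_trans (w1 n.+1).
    rewrite le_eqVlt; apply/orP; left; apply/eqP; apply: eq_big_nat => j.
    by rewrite ltnS subSS => /andP[_ jn]; rewrite subKn.
  apply: le_trans (jensen_sub0 phi_convex (fun j => w0 (n - j)%N) t0 wrev).
  by rewrite lerD2r incr.
have: \sum_(0 <= n < N) psi `|convolution a u n|
    <= \sum_(0 <= n < N) psi (A * `|u n|).
  apply: le_trans (ler_sum _ (fun n _ => pointwise n)) _.
  rewrite sum_convolution; apply: ler_sum => j _.
  by rewrite ler_piMl // subr_ge0 incr.
by rewrite !sumrB lerD2r.
Qed.

(** * Comparison of limits superior *)

Lemma limn_esup_le_near (R : realType) (u v : (\bar R)^nat) :
  (forall e : R, 0 < e -> \forall n \near \oo, (u n <= v n + e%:E)%E) ->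
  (limn_esup u <= limn_esup v)%E.
Proof.
move=> uv; apply/lee_addgt0Pr => e e0.
rewrite -leeBlDr //; apply: le_ereal_inf_tmp => _ [B B_oo <-].
rewrite leeBlDr //.
apply: ge_ereal_inf; exists (ereal_sup (u @` (B `&` [set n | (u n <= v n + e%:E)%E]))).
  by exists (B `&` [set n | (u n <= v n + e%:E)%E]) => //; apply: filterI => //; exact: uv.
apply: ge_ereal_sup => _ [n [Bn /= un] <-].
apply: le_trans un _; rewrite leeD2r //.
by apply: ereal_sup_ubound; exists n.
Qed.

Lemma limsup_mean_le (R : realType) (u v : R^nat) (C : R) :
  (forall n, \sum_(0 <= j < n.+1) u j <= \sum_(0 <= j < n.+1) v j + C) ->
  (limsup_mean u <= limsup_mean v)%E.
Proof.
move=> uv; apply: limn_esup_le_near => e e0.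
near=> n.
have n0 : 0 < n%:R :> R by rewrite ltr0n; near: n; exact: nbhs_infty_gt.
have Cn : C / e <= n%:R by near: n; exact: nbhs_infty_ger.
rewrite -EFinD lee_fin.
rewrite ler_pdivrMr // in Cn.
rewrite mulrC ler_pdivrMr // mulrDl mulrAC mulVf ?gt_eqF // mul1r.
by apply: le_trans (uv n) _; lra.
Unshelve. all: by end_near. Qed.

(** * Variation of constants *)

(** Up to index [n], convolutions are coefficients of products of truncated
generating polynomials, so associativity is that of [{poly R}]. *)
Lemma convolutionA (R : realType) (a b c : R^nat) :
  convolution (convolution a b) c = convolution a (convolution b c).
Proof.
apply/funext => n.
pose P (u : R^nat) : {poly R} := \poly_(i < n.+1) u i.
have PM (u v : R^nat) m : (m <= n)%N -> convolution u v m = (P u * P v)`_m.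
  move=> mn; rewrite /convolution big_mkord coefMr; apply: eq_bigr => j _.
  have jm : (j <= m)%N by rewrite -ltnS.
  by rewrite !coef_poly !ltnS (leq_trans (leq_subr _ _)) // (leq_trans jm).
have -> : convolution (convolution a b) c n = (P a * P b * P c)`_n.
  rewrite /convolution big_mkord coefMr; apply: eq_bigr => j _.
  rewrite [(P c)`_j]coef_poly ltn_ord; congr (_ * _).
  by apply: PM; exact: leq_subr.
rewrite -mulrA coefMr /convolution big_mkord; apply: eq_bigr => j _.
rewrite coef_poly ltnS leq_subr; congr (_ * _).
by apply/esym/PM; rewrite -ltnS.
Qed.

Lemma convolutionSl (R : realType) (a u : R^nat) (n : nat) :
  convolution a u n.+1 = convolution (fun i => a i.+1) u n + a 0%N * u n.+1.
Proof.
rewrite /convolution big_nat_recr //= subnn; congr (_ + _).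
by apply: eq_big_nat => j; rewrite ltnS => /andP[_ jn]; rewrite subSn.
Qed.

(** The initial value of a solution, viewed as the forcing term at time [0]. *)
Definition forcing (R : realType) (xi : R) (H : R^nat) : R^nat :=
  fun n => if n is 0%N then xi else H n.

(** Since [r] shifted by one is [k * r], associativity shows that [r * h], with
[h] the forcing term, satisfies the equation that determines [x] recursively. *)
Lemma volterra_variation_of_constants (R : realType) (k r H x : R^nat) (xi : R) :
  is_resolvent k r -> is_volterra_solution k H xi x ->
  x = convolution r (forcing xi H).
Proof.
move=> [r0 rS] [x0 xS]; apply/funext => n.
elim/ltn_ind: n => -[_|n IHn].
  by rewrite x0 /convolution big_nat1 subn0 r0 mul1r.
rewrite xS convolutionSl r0 mul1r; congr (_ + _).
have -> : (fun i => r i.+1) = convolution k r by apply/funext.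
rewrite convolutionA; apply: eq_big_nat => j /andP[_ jn].
by rewrite IHn.
Qed.

(** The coefficients of [1 - z K(z)], where [K] is the generating series of
[k]; its reciprocal is the generating series of the resolvent. *)
Definition characteristic_kernel (R : realType) (k : R^nat) : R^nat :=
  fun n => if n is m.+1 then - k m else 1.

Lemma forcing_eq_convolution (R : realType) (k H x : R^nat) (xi : R) :
  is_volterra_solution k H xi x ->
  forcing xi H = convolution (characteristic_kernel k) x.
Proof.
move=> [x0 xS]; apply/funext => -[|n].
  by rewrite /convolution big_nat1 /= mul1r x0.
rewrite convolutionSl /= mul1r xS addrA /convolution -big_split big1 ?add0r //.
by move=> j _ /=; ring.
Qed.

(** * Kernel norms and the forcing term at time zero *)

Lemma sum_norm_le_l1norm (R : realType) (u : R^nat) (n : nat) :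
  abs_summable u -> \sum_(0 <= i < n) `|u i| <= l1norm u.
Proof.
move=> su; apply: (nondecreasing_cvgn_le _ su n).
by apply: nondecreasing_series => i _ _; rewrite normr_ge0.
Qed.

Lemma sum_phi_forcing (R : realType) (f : R -> R) (xi : R) (H : R^nat) (n : nat) :
  \sum_(0 <= j < n.+1) f `|forcing xi H j|
    = \sum_(0 <= j < n.+1) f `|H j| + (f `|xi| - f `|H 0%N|).
Proof. by rewrite !big_nat_recl //=; ring. Qed.

Theorem theorem3p2 (R : realType) (k r H x : R^nat) (xi : R) (phi : R -> R)
  (k_summable : abs_summable k)
  (r_resolvent : is_resolvent k r)
  (r_summable : abs_summable r)
  (x_solution : is_volterra_solution k H xi x)
  (phi_ge0 : forall t : R, 0 <= t -> 0 <= phi t)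
  (phi_increasing : {in `[0, +oo[ &, {homo phi : s t / s <= t}})
  (phi_convex : convex_function (`[0, +oo[%classic : set R) phi) :
  (limsup_mean (fun j => phi `|x j|)%R
     <= limsup_mean (fun j => phi (l1norm r * `|H j|))%R)%E /\
  (limsup_mean (fun j => phi `|H j|)%R
     <= limsup_mean (fun j => phi ((1 + l1norm k) * `|x j|))%R)%E.
Proof.
split.
- have r_gt0 : 0 < l1norm r.
    have := sum_norm_le_l1norm 1 r_summable.
    by rewrite big_nat1 (proj1 r_resolvent) normr1; apply: lt_le_trans.
  apply: (limsup_mean_le (C := phi (l1norm r * `|xi|)
                               - phi (l1norm r * `|H 0%N|))) => n.
  have /= <- := sum_phi_forcing (fun t => phi (l1norm r * t)) xi H n.
  rewrite (volterra_variation_of_constants r_resolvent x_solution).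
  apply: sum_phi_convolution => // m; exact: sum_norm_le_l1norm.
- have k_ge0 : 0 <= l1norm k.
    by have := sum_norm_le_l1norm 0 k_summable; rewrite big_nil.
  apply: (limsup_mean_le (C := phi `|H 0%N| - phi `|xi|)) => n.
  have := sum_phi_forcing phi xi H n.
  suff: \sum_(0 <= j < n.+1) phi `|forcing xi H j|
      <= \sum_(0 <= j < n.+1) phi ((1 + l1norm k) * `|x j|) by lra.
  rewrite (forcing_eq_convolution x_solution).
  apply: sum_phi_convolution => //; first lra.
  case=> [|m]; first by rewrite big_nil; lra.
  rewrite big_nat_recl //= normr1 lerD2l.
  under eq_bigr do rewrite normrN.
  exact: sum_norm_le_l1norm.
Qed.
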